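(* Let $R$ be a multiplicative hyperring and let $I$ be a proper hyperideal of $R$. Then $I$ is $J$-prime if and only if $R-I$ is a $J$-multiplicatively closed subset of $R$.
   Context: A multiplicative hyperring is a nonempty set $R$ with an operation $+$ and a hyperoperation $\circ: R\times R\to P^*(R)$ (where $P^*(R)$ is the set of nonempty subsets of $R$) such that: $(R,+)$ is an abelian group; $\circ$ is associative; $a\circ(b+c)\subseteq a\circ b+a\circ c$ and $(b+c)\circ a\subseteq b\circ a+c\circ a$; and $a\circ(-b)=(-a)\circ b=-(a\circ b)$ for all $a,b,c\in R$. For nonempty subsets $A,B\subseteq R$, $A\circ B=\bigcup_{x\in A,\,y\in B}x\circ y$, and $A\circ r=A\circ\{r\}$. Standing assumptions: $R$ is commutative with an identity $1$, meaning $a\in a\circ 1$ for all $a\in R$. A hyperideal of $R$ is a nonempty subset $I\subseteq R$ with $a-b\in I$ for $a,b\in I$ and $r\circ x\subseteq I$ for $x\in I$, $r\in R$. Let $\mathbf{C}=\{r_1\circ r_2\circ\cdots\circ r_n : r_i\in R,\ n\in\mathbb{N}\}$; a hyperideal $I$ is a $\mathbf{C}$-hyperideal if for every $A\in\mathbf{C}$, $A\cap I\neq\varnothing$ implies $A\subseteq I$. Standing assumption: all hyperideals are $\mathbf{C}$-hyperideals. A proper hyperideal $M$ is maximal if every hyperideal $N$ with $M\subsetneq N\subseteq R$ equals $R$; the Jacobson radical $J(R)$ is the intersection of all maximal hyperideals of $R$. A proper hyperideal $I$ is $J$-prime if for all $x,y\in R$, $x\circ y\subseteq I$ implies $x\in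 J(R)$ or $y\in I$. For $X\subseteq R$, $R-X$ denotes the set-theoretic complement. A nonempty subset $S$ of $R$ containing $R-J(R)$ is called $J$-multiplicatively closed if $x\circ y\subseteq S$ for every $x\in R-J(R)$ and every $y\in S$. *)

(* Defs.v *)
From HB Require Import structures.
From mathcomp Require Import all_boot all_algebra.
From mathcomp Require Import boolp classical_sets.

Set Implicit Arguments.
Unset Strict Implicit.
Unset Printing Implicit Defensive.

Import GRing.Theory.
Local Open Scope classical_set_scope.
Local Open Scope ring_scope.

Definition set_hmul (T : Type) (op : T -> T -> set T) (A B : set T) : set T :=
  \bigcup_(x in A) \bigcup_(y in B) op x y.

(* The codomain P^*(R) of the hyperoperation is rendered as [set R] together
   with the nonemptiness axiom [hmul_nonempty]. *)
HB.mixin Record Zmodule_isMulHyperring R of GRing.Zmodule R := {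
  hmul : R -> R -> set R;
  hmul_nonempty : forall a b, hmul a b !=set0;
  hmulA : forall a b c,
    set_hmul hmul [set a] (hmul b c) = set_hmul hmul (hmul a b) [set c];
  hmulDr_sub : forall a b c,
    hmul a (b + c) `<=` [set x + y | x in hmul a b & y in hmul a c];
  hmulDl_sub : forall a b c,
    hmul (b + c) a `<=` [set x + y | x in hmul b a & y in hmul c a];
  hmulrN : forall a b, hmul a (- b) = [set - x | x in hmul a b];
  hmulNr : forall a b, hmul (- a) b = [set - x | x in hmul a b]
}.

#[short(type="mulHyperringType")]
HB.structure Definition MulHyperring :=
  { R of GRing.Zmodule R & Zmodule_isMulHyperring R }.

(* The identity is weak: [a] belongs to [a o 1], which need not be [{a}]. *)
HB.mixin Record MulHyperring_isComUnital R of MulHyperring R := {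
  hone : R;
  hmulC : forall a b : R, hmul a b = hmul b a;
  mem_hmul1 : forall a : R, hmul a hone a
}.

#[short(type="comMulHyperringType")]
HB.structure Definition ComMulHyperring :=
  { R of MulHyperring R & MulHyperring_isComUnital R }.

Section Hyperideals.
Variable R : comMulHyperringType.
Implicit Types (I M N S A B : set R) (x y r : R) (s : seq R).

Definition hyperideal I : Prop :=
  [/\ I !=set0,
      forall a b, I a -> I b -> I (a - b)
    & forall r x, I x -> hmul r x `<=` I].

Definition proper_hyperideal I : Prop := hyperideal I /\ I <> [set: R].

(* [hprod r s] is the product of the nonempty sequence [r :: s]; for [s] empty
   it is the singleton [{r}]. *)
Definition hprod r s : set R :=
  foldl (fun A x => set_hmul hmul A [set x]) [set r] s.

Definition hprods : set (set R) := [set A | exists r s, A = hprod r s].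

Definition C_hyperideal I : Prop :=
  hyperideal I /\ forall A, hprods A -> A `&` I !=set0 -> A `<=` I.

Definition maximal_hyperideal M : Prop :=
  proper_hyperideal M /\
  forall N, hyperideal N -> M `<` N -> N = [set: R].

End Hyperideals.

Definition jacobson_radical (R : comMulHyperringType) : set R :=
  \bigcap_(M in [set M : set R | maximal_hyperideal M]) M.
Arguments jacobson_radical R : clear implicits.

Section JPrime.
Variable R : comMulHyperringType.
Implicit Types I S : set R.

Definition J_prime I : Prop :=
  proper_hyperideal I /\
  forall x y, hmul x y `<=` I -> jacobson_radical R x \/ I y.

Definition J_mult_closed S : Prop :=
  [/\ S !=set0,
      ~` jacobson_radical R `<=` S
    & forall x y, (~` jacobson_radical R) x -> S y -> hmul x y `<=` S].

End JPrime.

(* Main.v *)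
Require Import Defs.
From HB Require Import structures.
From mathcomp Require Import all_boot all_algebra.
From mathcomp Require Import boolp classical_sets.

(** The closure condition on the complement of [I] says that, for [x] outside
    [J(R)], [y] outside [I] forces [hmul x y] to be disjoint from [I], whereas
    the contrapositive of J-primeness only says that [hmul x y] is not contained
    in [I].  The two agree because [I] is a C-hyperideal: a product of two
    elements either lies in [I] or misses it ([C_hyperideal_hmul_sub]).
    Conversely, a product missing [I] cannot lie in [I], as it is nonempty.
    The remaining clause, that the complement of [J(R)] misses [I], amounts to
    [I] being contained in [J(R)]; this follows by applying J-primeness to
    [hmul x hone] with [x] in [I], since a proper hyperideal avoids the
    identity. *)

Local Open Scope classical_set_scope.
Local Open Scope ring_scope.

Lemma set_hmul11 (T : Type) (op : T -> T -> set T) (x y : T) :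
  set_hmul op [set x] [set y] = op x y.
Proof. by rewrite /set_hmul !bigcup_set1. Qed.

Lemma hprods_hmul (R : comMulHyperringType) (x y : R) : hprods (hmul x y).
Proof. by exists x, [:: y]; rewrite /hprod /= set_hmul11. Qed.

Lemma C_hyperideal_hmul_sub (R : comMulHyperringType) (I : set R) (x y z : R) :
  C_hyperideal I -> hmul x y z -> I z -> hmul x y `<=` I.
Proof.
by move=> [_ CI] xyz Iz; apply: CI; [exact: hprods_hmul | exists z].
Qed.

(** The identity being weak, [a] is recovered from
    [I hone] by absorption, as a member of [hmul a hone], not by an equation. *)
Lemma proper_hyperideal_hone (R : comMulHyperringType) (I : set R) :
  proper_hyperideal I -> ~ I (hone : R).
Proof.
move=> [[_ _ absI] IT] I1; apply: IT; apply/seteqP; split=> // a _.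
exact: absI I1 _ (mem_hmul1 a).
Qed.

Lemma J_prime_sub_jacobson (R : comMulHyperringType) (I : set R) :
  J_prime I -> I `<=` jacobson_radical R.
Proof.
move=> [properI primeI] x Ix.
have x1I : hmul x hone `<=` I.
  by rewrite hmulC; case: properI => [[_ _ absI] _]; exact: absI.
by case: (primeI _ _ x1I) => // /(proper_hyperideal_hone _ _ properI).
Qed.

Theorem theorem3p23 (R : comMulHyperringType)
    (all_C : forall N : set R, hyperideal N -> C_hyperideal N)
    (I : set R) (properI : proper_hyperideal I) :
  J_prime I <-> J_mult_closed (~` I).
Proof.
split=> [primeI | [_ _ closedI]].
  split.
  - by apply/set0P/eqP; rewrite -setCT => /setC_inj; case: properI.
  - exact: subsetC (J_prime_sub_jacobson _ _ primeI).
  - move=> x y nJx nIy z xyz Iz; have CI := all_C _ (proj1 properI).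
    by case: (proj2 primeI _ _ (C_hyperideal_hmul_sub _ _ _ _ _ CI xyz Iz)).
split=> // x y xyI.
have [Jx|nJx] := pselect (jacobson_radical R x); first by left.
right; apply: contrapT => nIy.
have [z xyz] := hmul_nonempty x y.
exact: (closedI _ _ nJx nIy _ xyz) (xyI _ xyz).
Qed.
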